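(* Let $X$ be an infinite set, and let $S$ be a subsemigroup of $\mathrm{Inj}_X$ such that $S\setminus \mathrm{BL}_X$ is $|X|$-transitive. Then the following are equivalent: (1) $\omega_S^r$ is finitely generated and $D_r(S)=4$; (2) $\omega_S^r$ is finitely generated; (3) $S^r$ is finitely generated and $S\cap \mathrm{BL}_X\neq\emptyset$; (4) $S^r$ is finitely generated and $S$ contains $\mathrm{BL}_X$.
   Context: Maps are written on the right and composed from left to right. $\mathcal T_X$ is the monoid of all maps $X\to X$; $\mathrm{Inj}_X$ is the submonoid of injective maps; $\mathrm{BL}_X=\{\alpha\in \mathrm{Inj}_X : |X\setminus \operatorname{im}\alpha|=|X|\}$ is the Baer-Levi semigroup. (For a subsemigroup $S$ of $\mathrm{Inj}_X$, the set $S\setminus\mathrm{BL}_X$ is a possibly empty subsemigroup of $S$.) For a cardinal $\kappa\leq|X|$, a subsemigroup $T$ of $\mathcal T_X$ is $\kappa$-transitive if for every partial bijection $\lambda$ on $X$ (injective partial map $X\to X$) with $|\operatorname{dom}\lambda|\leq\kappa$ and $|X\setminus\operatorname{dom}\lambda|=|X\setminus\operatorname{im}\lambda|=|X|$ there is some $\theta\in T$ with $\theta|_{\operatorname{dom}\lambda}=\lambda$. For a semigroup $S$, $S^1$ is $S$ with an identity adjoined if $S$ has none ($S^1=S$ if $S$ is a monoid). ''$S^r$ is finitely generated'' means that $S=VS^1$ for some finite $V\subseteq S$. A right congruence on $S$ is an equivalence relation $\rho$ such that $(a,b)\in\rho$ implies $(as,bs)\in\rho$ for all $s\in S$; $\langle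 U\rangle$ denotes the smallest right congruence containing $U\subseteq S\times S$. The universal relation $S\times S$ viewed as a right congruence is denoted $\omega_S^r$; it is finitely generated if $\omega_S^r=\langle U\rangle$ for some finite $U\subseteq S\times S$. A $U$-sequence of length $n\geq 1$ from $a$ to $b$ is a sequence $a=u_1s_1,\ v_1s_1=u_2s_2,\ \dots,\ v_ns_n=b$ where, for each $i$, $(u_i,v_i)\in U$ or $(v_i,u_i)\in U$, and $s_i\in S^1$; if $a=b$ then $a,b$ are related by a $U$-sequence of length $0$. If $\omega_S^r=\langle U\rangle$, let $d_U^r(a,b)$ be the least length of a $U$-sequence from $a$ to $b$ and $D_r(U,S)=\sup\{d_U^r(a,b):a,b\in S\}$. If $\omega_S^r$ is finitely generated, the right diameter of $S$ is $D_r(S)=\min\{D_r(U,S): \omega_S^r=\langle U\rangle,\ U\text{ finite}\}$. *)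

(* Defs.v *)
From HB Require Import structures.
From mathcomp Require Import all_boot all_order all_algebra.
From mathcomp Require Import boolp classical_sets functions cardinality.
From mathcomp Require Import constructive_ereal.

Set Implicit Arguments.
Unset Strict Implicit.
Unset Printing Implicit Defensive.

Local Open Scope classical_set_scope.
Local Open Scope card_scope.
Local Open Scope group_scope.

Section RightDiameter.
Variable S : semigroupType.
Implicit Types (U : set (S * S)) (V : set S).

Definition has_identity :=
  exists e : S, left_id e *%g /\ right_id e *%g.

(* The elements of S^1 inside option S: Some s is s, and None is the adjoined
   identity, which is present only when S has no identity of its own. *)
Definition S1 : set (option S) := [set o | o = None -> ~ has_identity].

Definition mul1 (a : S) (o : option S) : S := if o is Some s then a * s else a.

Definition right_fg :=
  exists V, finite_set V /\ [set mul1 v s | v in V & s in S1] = [set: S].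

Definition right_congruence (rho : set (S * S)) :=
  [/\ forall a, rho (a, a),
      forall a b, rho (a, b) -> rho (b, a),
      forall a b c, rho (a, b) -> rho (b, c) -> rho (a, c) &
      forall a b s, rho (a, b) -> rho (a * s, b * s)].

Definition generated_right_congruence U := smallest right_congruence U.

Definition generates_universal U :=
  generated_right_congruence U = [set: S * S].

Definition universal_fg :=
  exists U, finite_set U /\ generates_universal U.

Definition elementary_step U (a b : S) :=
  exists u v s, [/\ U (u, v) \/ U (v, u), S1 s, a = mul1 u s & b = mul1 v s].

(* w 0 = a, w n = b, and w i = v_i s_i = u_{i+1} s_{i+1} for 0 < i < n. *)
Definition U_sequence U (n : nat) (a b : S) :=
  exists w : nat -> S, [/\ w 0%N = a, w n = b &
    forall i, (i < n)%N -> elementary_step U (w i) (w i.+1)].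

Definition is_right_distance U (a b : S) (n : nat) :=
  U_sequence U n a b /\ forall m, U_sequence U m a b -> (n <= m)%N.

(* d = D_r(U,S); the supremum is taken in \bar int, as it may be +oo. *)
Definition is_right_diameter_wrt U (d : \bar int) :=
  supremums
    [set (n%:Z)%:E | n in [set n | exists a b, is_right_distance U a b n]] d.

(* d = D_r(S), the minimum of D_r(U,S) over the finite generating sets U. *)
Definition is_right_diameter (d : \bar int) :=
  let D := [set d | exists U, [/\ finite_set U, generates_universal U &
                                  is_right_diameter_wrt U d]] in
  D d /\ lbound D d.

End RightDiameter.

Definition transf (X : Type) := X -> X.

HB.instance Definition _ (X : Type) := gen_eqMixin (transf X).
HB.instance Definition _ (X : Type) := gen_choiceMixin (transf X).

Section FullTransformationMonoid.
Variable X : Type.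

(* Maps act on the right, so a * b is "first a, then b". *)
Definition transf_mul (a b : transf X) : transf X := fun x => b (a x).
Definition transf_one : transf X := fun x => x.

Lemma transf_mulA : associative transf_mul. Proof. by []. Qed.
Lemma transf_mul1 : left_id transf_one transf_mul. Proof. by []. Qed.
Lemma transf_mulr1 : right_id transf_one transf_mul. Proof. by []. Qed.

HB.instance Definition _ :=
  isMonoid.Build (transf X) transf_mulA transf_mul1 transf_mulr1.

Definition inj_maps : set (transf X) := [set a | injective a].

Definition baer_levi : set (transf X) :=
  [set a | injective a /\ ~` range a #= [set: X]].

(* The cardinal kappa <= |X| is that of the subset K of X.  A partial bijection
   is given by its domain D and any map f, injective on D, of which it is the
   restriction to D. *)
Definition transitive_wrt (K : set X) (T : set (transf X)) :=
  forall (D : set X) (f : X -> X),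
    set_inj D f -> D #<= K ->
    ~` D #= [set: X] -> ~` (f @` D) #= [set: X] ->
    exists2 theta, T theta & forall x, D x -> theta x = f x.

End FullTransformationMonoid.

(* A subsemigroup of the monoid of all maps, as a semigroup in its own right. *)
Record sub_semigroup (X : Type) (S : mulgClosed (transf X)) := SubSemigroup {
  transf_of : transf X;
  _ : transf_of \in S
}.

HB.instance Definition _ (X : Type) (S : mulgClosed (transf X)) :=
  [isSub for @transf_of X S].
HB.instance Definition _ (X : Type) (S : mulgClosed (transf X)) :=
  [Choice of sub_semigroup S by <:].
HB.instance Definition _ (X : Type) (S : mulgClosed (transf X)) :=
  SubChoice_isSubSemigroup.Build (transf X) (fun a => a \in S)
    (sub_semigroup S) (@gpredM _ S).

(* Main.v *)
Require Import Defs.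
From mathcomp Require Import all_boot all_order all_algebra.
From mathcomp Require Import boolp classical_sets functions cardinality.
From mathcomp Require Import constructive_ereal.

Local Open Scope classical_set_scope.

Import Order.TTheory GRing.Theory Num.Theory.

(** Call a subset of X large when it has as many elements as X, and small
otherwise.  Elements of S are injective, and those outside BL are the maps whose
image has a small complement.  Below, a product a b is a followed by b, and a p is
the value of a at the point p.

If some alpha in S lies in BL, then every gamma in BL equals alpha theta, where
theta in S extends the partial bijection alpha^{-1} gamma; so S contains BL
([baer_levi_sub]).

Suppose that S = V S^1 with V finite, and that S contains BL.  Fix injections
e0, e1, e2 of X with disjoint images, and let U consist of the pairs (v, e0) and
(v, e1) for v in V, together with (e0, e1).  One step leads from a = v s to
either of c0 = e0 s and c1 = e1 s, and likewise from b = v' t to d0 = e0 t and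
d1 = e1 t.  The images of c0 and c1 are disjoint, so a large part of the image
of d1 avoids one of them, say that of c0; it also avoids the image of d0.  Hence
there is an injection h whose image avoids those of c0 and d0 and leaves enough
room outside the three, and by transitivity there are elements r and r' of S with
c0 = e0 r, e1 r = h = e1 r', e0 r' = d0.  So a and b are at distance at most 4
([sequence_length4]).

If the universal right congruence is generated by a finite U, then every element
but one is reached by a step, which writes it as v s with v an entry of U, so S^r
is finitely generated ([universal_fg_right_fg]).

For the lower bound, and for the existence of an element of BL in S, a path from
a to b is read off as a partial map relating a and b.  If f = u s and g = v s,
then f p = g x whenever u p = v x.  When u and v are injective and the complement
of the image of u is small, infinitely many p take part in such a coincidence
([infinite_coincidence]).  A path of length 3 through (u1,v1), (u2,v2), (u3,v3)
forces  a p = b q  exactly when  u2 x = v2 y,  as soon as  u1 p = v1 x  and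
v3 q = u3 y.  When no entry of U lies in BL, a path of any length forces
b x = a (g x)  for a partial injection g, composed from the pairs of the path,
whose domain has a small complement.  In both cases there are only countably
many constraints  a p = b q <-> R p q,  each with infinitely many p and
infinitely many q available, and transitivity yields a, b in S \ BL that violate
each of them at a point of its own ([separation]).  Hence no finite U makes all
distances at most 3 ([distance_ge4]), and the universal right congruence is not
finitely generated when S avoids BL ([universal_fg_baer_levi]).

The cardinal arithmetic behind this is that X contains infinitely many disjoint
copies of itself and that a union of two small sets is small; both rest on the
embeddability of A x nat into A for infinite A, obtained from Zorn's lemma. *)

(** * Cardinals of infinite sets *)

Section Cardinals.
Local Open Scope card_scope.

Lemma card_le_fun {T U : Type} (A : set T) (B : set U) (f : T -> U) :
  set_fun A B f -> set_inj A f -> A #<= B.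
Proof.
move=> fAB finj.
have /injfunPex[g] : exists2 f : T -> U, set_fun A B f & set_inj A f by exists f.
exact: inj_card_le g.
Qed.

Lemma card_leE {T U : Type} (A : set T) (B : set U) : U -> A #<= B ->
  exists2 f : T -> U, set_fun A B f & set_inj A f.
Proof.
elim/Ppointed: U => U in B *; first by move=> u; case: (no u).
by move=> _ /pcard_leP/injfunPex.
Qed.

(** A partial bijection between A and B is a family of pairs (a, b) whose
doubletons [{inl a; inr b}] are pairwise disjoint; a maximal such family exhausts
A or B. *)
Lemma card_le_total {T U : Type} (A : set T) (B : set U) : A #<= B \/ B #<= A.
Proof.
pose F (p : T * U) : set (T + U) := [set inl p.1; inr p.2].
have [E [EAB Etriv Emax]] := ex_maximal_disjoint_subcollection F (A `*` B).
have fstI : set_inj E fst.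
  move=> p q /set_mem Ep /set_mem Eq pq.
  by apply: Etriv => //; exists (inl p.1); split; left => //; rewrite pq.
have sndI : set_inj E snd.
  move=> p q /set_mem Ep /set_mem Eq pq.
  by apply: Etriv => //; exists (inr p.2); split; right => //; rewrite pq.
have [AE|/existsNP[a /not_implyP[Aa aE]]] := pselect (A `<=` fst @` E).
  left; apply: card_le_trans (subset_card_le AE) _.
  apply: card_le_trans (card_image_le _ _) _.
  by apply: (card_le_fun _ _ snd) => // p /EAB[].
have [BE|/existsNP[b /not_implyP[Bb bE]]] := pselect (B `<=` snd @` E).
  right; apply: card_le_trans (subset_card_le BE) _.
  apply: card_le_trans (card_image_le _ _) _.
  by apply: (card_le_fun _ _ fst) => // p /EAB[].
exfalso; apply: (Emax (E `|` [set (a, b)])).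
- split; first by move=> p; left.
  by move=> /(_ (a, b) (or_intror erefl)) Eab; apply: aE; exists (a, b).
- by move=> p [/EAB//|->].
- move=> p q [Ep|->] [Eq|->] // [z [pz qz]]; first by apply: Etriv => //; exists z.
  + exfalso; case: pz qz => /= -> [] // [] pq; first by apply: aE; exists p.
    by apply: bE; exists p.
  + exfalso; case: qz pz => /= -> [] // [] pq; first by apply: aE; exists q.
    by apply: bE; exists q.
Qed.

(** A maximal family E of injective sequences in A with disjoint ranges covers
A up to a finite set, since any infinite remainder would contain one more sequence.
So E x nat embeds into A, and A embeds into E x (nat + nat), where the second
summand serves the finite remainder. *)
Lemma infinite_card_mul_nat {T : Type} (A : set T) : infinite_set A ->
  A `*` [set: nat] #<= A.
Proof.
move=> Ainf; have [a0 Aa0] := infinite_setN0 Ainf.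
pose B := [set s : nat -> T | injective s /\ range s `<=` A].
have [E [EB Etriv Emax]] :=
  ex_maximal_disjoint_subcollection (fun s : nat -> T => range s) B.
pose L := A `\` \bigcup_(s in E) range s.
have Lfin : finite_set L.
  apply: contrapT => /infiniteP/(card_leE _ _ a0)[s sL sinj].
  have {}sinj : injective s by move=> m n; apply: sinj; exact: mem_set.
  have notin t n k : E t -> s n <> t k.
    move=> Et stnk; have [_] := sL n I; apply.
    by exists t => //; exists k.
  apply: (Emax (E `|` [set s])).
  - split; first by move=> t; left.
    move=> /(_ s (or_intror erefl)) Es.
    by apply: (notin s 0%N 0%N).
  - by move=> t [/EB//|->]; split=> // _ [n _ <-]; have [] := sL n I.
  - move=> t u [Et|->] [Eu|->] // [z [[m _ <-] [n _ tu]]].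
    + by apply: Etriv => //; exists (t m); split; [exists m|exists n].
    + by case: (notin t n m).
    + by case: (notin u m n).
have [s0 Es0] : E !=set0.
  apply/set0P/eqP => E0; apply: Ainf; move: Lfin.
  by rewrite /L E0 bigcup_set0 setD0.
have [i _ iinj] := card_leE _ _ 0%N (finite_set_countable Lfin).
(* The sequence [l] enumerates the remainder [L], with default value [a0]. *)
pose l n := if pselect (exists2 x, L x & i x = n) is left e
            then sval (cid2 e) else a0.
have lL x : L x -> l (i x) = x.
  move=> Lx; rewrite /l; case: pselect => [e|[]]; last by exists x.
  case: cid2 => y /= Ly /iinj; apply; exact: mem_set.
pose g (p : (nat -> T) * (nat + nat)) :=
  match p.2 with inl n => p.1 n | inr n => l n end.
have AE : A #<= E `*` [set: nat + nat].
  apply: card_le_trans (card_image_le g _); apply: subset_card_le => x Ax.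
  have [[s Es [n _ <-]]|nx] := pselect ((\bigcup_(s in E) range s) x).
    by exists (s, inl n).
  by exists (s0, inr (i x)) => //; rewrite /g /= lL.
have [j jE jinj] := card_leE _ _ (s0, inl 0%N) AE.
apply: (card_le_fun _ _ (fun p => (j p.1).1 (pickle ((j p.1).2, p.2)))).
  by move=> [x n] [/= /jE[/EB[_ +] _] _]; apply; exists (pickle ((j x).2, n)).
move=> [x m] [y n] /set_mem[/= Ax _] /set_mem[/= Ay _] jxy.
have [[Ex _] [Ey _]] := (jE x Ax, jE y Ay).
have jxy1 : (j x).1 = (j y).1.
  apply: Etriv => //; exists ((j x).1 (pickle ((j x).2, m))).
  by split; [exists (pickle ((j x).2, m))|rewrite jxy; exists (pickle ((j y).2, n))].
move: jxy; rewrite jxy1 => /(EB _ Ey).1 /(pcan_inj pickleK) [jxy2 ->].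
congr (_, _); apply: jinj; try exact: mem_set.
by rewrite [j x]surjective_pairing jxy1 jxy2 -surjective_pairing.
Qed.

End Cardinals.

(** * Sets as large as the ambient set *)

Section LargeSets.
Context {X : Type}.
Hypothesis Xinf : infinite_set [set: X].
Local Open Scope card_scope.

(** The sets with as many elements as X; asking for an injective self-map of X
with values in A avoids choosing a map on the subtype. *)
Definition large (A : set X) := exists2 f : X -> X, injective f & forall x, A (f x).

Lemma card_eqT_large (A : set X) : A #= [set: X] <-> large A.
Proof.
rewrite card_eq_le card_leT /=; split=> [|[f finj fA]].
  have [x0 _] := infinite_setN0 Xinf.
  move=> /(card_leE _ _ x0)[f fA finj]; exists f => [x y|x]; last exact: fA.
  by apply: finj; exact: mem_set.
by apply: (card_le_fun _ _ f) => // x y _ _; exact: finj.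
Qed.

Lemma baer_levi_large (a : X -> X) :
  @baer_levi X a <-> injective a /\ large (~` range a).
Proof. by split=> -[? /card_eqT_large]. Qed.

Lemma large_sub (A B : set X) : A `<=` B -> large A -> large B.
Proof. by move=> AB [f finj fA]; exists f => // x; exact/AB/fA. Qed.

Lemma large_range (f : X -> X) : injective f -> large (range f).
Proof. by move=> finj; exists f => // x; exists x. Qed.

Lemma large_image (f : X -> X) (A : set X) :
  injective f -> large A -> large (f @` A).
Proof.
move=> finj [g ginj gA]; exists (f \o g); first exact: inj_comp.
by move=> x; exists (g x).
Qed.

Lemma large_infinite (A : set X) : large A -> infinite_set A.
Proof.
move=> /card_eqT_large; rewrite card_eq_le => /andP[_ XA] Afin.
exact/Xinf/(card_le_finite XA).
Qed.

(** If A is the smaller of the two sets, then B is infinite and the union embeds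
into two copies of B, hence into B. *)
Lemma largeU (A B : set X) : large (A `|` B) -> large A \/ large B.
Proof.
wlog AB : A B / A #<= B.
  move=> wl ABl; have [AB|BA] := card_le_total A B; first exact: wl.
  by rewrite setUC in ABl; have [] := wl _ _ BA ABl; [right|left].
have [x0 _] := infinite_setN0 Xinf.
have [f fAB finj] := card_leE _ _ x0 AB.
move=> ABl; right; have Binf : infinite_set B.
  move=> Bfin; apply: (large_infinite _ ABl); rewrite finite_setU; split => //.
  exact: card_le_finite AB Bfin.
have [g gB ginj] := card_leE _ _ x0 (infinite_card_mul_nat B Binf).
have [h hinj hAB] := ABl.
have notA x : ~ A (h x) -> B (h x) by case: (hAB x).
pose k x := if pselect (A (h x)) then (f (h x), 0%N) else (h x, 1%N).
have kB x : (B `*` setT) (k x).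
  by rewrite /k; case: pselect => Ax; split=> //; [exact: fAB|exact: notA].
exists (g \o k) => [x y /= kxy|x]; last exact: gB.
have : k x = k y by apply: ginj => //; exact: mem_set.
rewrite /k; case: pselect => Ax; case: pselect => Ay // [].
  by move=> /finj fxy; apply/hinj/fxy; exact: mem_set.
exact: hinj.
Qed.

Lemma disjoint_copies : exists e : nat -> X -> X,
  forall i j x y, e i x = e j y -> i = j /\ x = y.
Proof.
have [x0 _] := infinite_setN0 Xinf.
have [g _ ginj] := card_leE _ _ x0 (infinite_card_mul_nat _ Xinf).
exists (fun i x => g (x, i)) => i j x y /ginj.
by rewrite !in_setE => /(_ (conj I I) (conj I I)) [-> ->].
Qed.

(** Shifting p n to the odd position p (2n + 1) and fixing every other point is
an injection of X that misses the values of p at even positions.  This frees a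
large set from any countable selection, whether or not X is countable. *)
Lemma large_compl_even_range (p : nat -> X) :
  injective p -> large (~` range (p \o double)).
Proof.
move=> pinj.
pose f x := if pselect (exists n, p n = x) is left e
            then p (sval (cid e)).*2.+1 else x.
have fp n : f (p n) = p n.*2.+1.
  rewrite /f; case: pselect => [e|[]]; last by exists n.
  by case: cid => m /= /pinj ->.
have fN x : ~ (exists n, p n = x) -> f x = x by rewrite /f; case: pselect.
exists f => [x y|x [n _]].
  have [[m <-]|xp] := pselect (exists n, p n = x);
  have [[n <-]|yp] := pselect (exists n, p n = y); rewrite ?fp ?fN //.
  - by move=> /pinj [] /double_inj ->.
  - by move=> pmy; case: yp; exists m.*2.+1.
  - by move=> xpn; case: xp; exists n.*2.+1.
have [[m <-]|xp] := pselect (exists n, p n = x).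
  by rewrite fp => /pinj /(congr1 odd); rewrite /= !odd_double.
by rewrite fN // => px; apply: xp; exists n.*2.
Qed.

(** The points are chosen one after the other, each outside the finite set of
those chosen before. *)
Lemma injective_selector (A : nat -> set X) : (forall n, infinite_set (A n)) ->
  exists2 p : nat -> X, injective p & forall n, A n (p n).
Proof.
move=> Ainf.
have [x0 _] := infinite_setN0 Xinf.
have /choice[f fP] : forall nF : nat * set X,
    exists x, finite_set nF.2 -> A nF.1 x /\ ~ nF.2 x.
  move=> [n F] /=; have [Ffin|] := pselect (finite_set F); last by exists x0.
  have [x xAF] : A n `\` F !=set0 by apply/infinite_setN0/infinite_setD.
  by exists x.
(* [L n] is the set of the points chosen before stage n. *)
pose L := fix L n := if n is m.+1 then L m `|` [set f (m, L m)] else set0.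
have Lfin n : finite_set (L n) by elim: n => //= n IHn; rewrite finite_setU.
exists (fun n => f (n, L n)); last by move=> n; have [] := fP (n, L n) (Lfin n).
have inL m n : (m < n)%N -> L n (f (m, L m)).
  elim: n => // n IHn; rewrite ltnS leq_eqVlt => /predU1P[->|/IHn]; first by right.
  by left.
have lt_neq m n : (m < n)%N -> f (m, L m) <> f (n, L n).
  move=> /inL Lm fmn; have [_ /=] := fP (n, L n) (Lfin n).
  by rewrite -fmn.
move=> m n fmn; case: (ltngtP m n) => // /lt_neq; first by case.
by move/(_ (esym fmn)).
Qed.

End LargeSets.

(** * Sequences, generation and diameter in a semigroup *)

Section Sequences.
Context {S : semigroupType}.
Local Open Scope group_scope.
Implicit Types (U : set (S * S)) (a b c : S).

(** Only through such an element is a pair of U itself a step.  It is the identity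
of S if there is one, and the adjoined identity otherwise. *)
Lemma S1_unit : exists2 o : option S, S1 o & forall a, mul1 a o = a.
Proof.
have [[e [e1 e2]]|noe] := pselect (has_identity S); last by exists None.
by exists (Some e) => //.
Qed.

Lemma U_sequence0 U a b : U_sequence U 0 a b <-> a = b.
Proof. by split=> [[w [<- <-]]|<-]; last by exists (fun=> a). Qed.

Lemma U_sequenceSr U n a b : U_sequence U n.+1 a b <->
  exists c, U_sequence U n a c /\ elementary_step U c b.
Proof.
split=> [[w [wa wb wstep]]|[c [[w [wa wc wstep]] cb]]].
  exists (w n); split; last by rewrite -wb; exact: wstep.
  by exists w; split=> // i /ltnW; exact: wstep.
exists (fun i => if (i <= n)%N then w i else b); split=> //; first by rewrite ltnn.
move=> i; rewrite ltnS => lein; rewrite lein.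
move: lein; rewrite leq_eqVlt => /predU1P[->|ltin]; first by rewrite ltnn wc.
by rewrite ltin; exact: wstep.
Qed.

Lemma U_sequence1 U a b : U_sequence U 1 a b <-> elementary_step U a b.
Proof.
rewrite U_sequenceSr; split=> [[c [/U_sequence0 <-]]//|ab].
by exists a; split=> //; exact/U_sequence0.
Qed.

Lemma U_sequence_trans U m n a b c :
  U_sequence U m a b -> U_sequence U n b c -> U_sequence U (m + n) a c.
Proof.
move=> ab; elim: n c => [|n IHn] c; first by move/U_sequence0 => <-; rewrite addn0.
rewrite addnS !U_sequenceSr => -[d [/IHn ad dc]].
by exists d.
Qed.

Lemma elementary_step_sym U a b : elementary_step U a b -> elementary_step U b a.
Proof. by move=> [u [v [s [/or_comm uv]]]]; exists v, u, s. Qed.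

Lemma U_sequence_sym U n a b : U_sequence U n a b -> U_sequence U n b a.
Proof.
elim: n b => [|n IHn] b; first by move/U_sequence0 => ->; apply/U_sequence0.
move=> /U_sequenceSr[c [/IHn ca /elementary_step_sym/U_sequence1 bc]].
exact: U_sequence_trans bc ca.
Qed.

Lemma U_sequence_mulr U n a b s : U_sequence U n a b -> U_sequence U n (a * s) (b * s).
Proof.
move=> [w [<- <- wstep]]; exists (fun i => w i * s); split=> // i /wstep.
move=> [u [v [o [uv _ -> ->]]]].
exists u, v, (Some (if o is Some t then t * s else s)); split=> //.
  by case: o => [t|] //=; rewrite mulgA.
by case: o => [t|] //=; rewrite mulgA.
Qed.

(** Being joined by some U-sequence is the right congruence generated by U. *)
Lemma generates_universalP U :
  generates_universal U <-> forall a b, exists n, U_sequence U n a b.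
Proof.
split=> [Ugen a b|Useq].
  suff : generated_right_congruence U `<=`
         [set p | exists n, U_sequence U n p.1 p.2].
    by rewrite Ugen => /(_ (a, b) I).
  apply: smallest_sub => [|[u v] Uuv].
    split=> [c|c d [n]|c d e [m cd] [n de]|c d s [n cd]] /=.
    - by exists 0%N; apply/U_sequence0.
    - by move=> /U_sequence_sym; exists n.
    - by exists (m + n)%N; exact: U_sequence_trans cd de.
    - by exists n; exact: U_sequence_mulr.
  have [o So o1] := S1_unit.
  exists 1%N; apply/U_sequence1; exists u, v, o; split; rewrite ?o1 //; by left.
apply/seteqP; split=> // -[a b] _ rho /= [[rhoxx rhoC rhoT rhoM] Urho].
have [n] := Useq a b; elim: n b => [|n IHn] b; first by move=> /U_sequence0 <-.
move=> /U_sequenceSr[c [/IHn ac [u [v [o [uv _ cE bE]]]]]].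
apply: rhoT ac _; rewrite cE bE.
have {}uv : rho (u, v) by case: uv => /Urho // /rhoC.
by case: o {cE bE} => [s|] //=; exact: rhoM.
Qed.

Lemma exists_right_distance U a b : generates_universal U ->
  exists n, is_right_distance U a b n.
Proof.
move=> /generates_universalP/(_ a b) Uab.
have ex : exists n, `[< U_sequence U n a b >] by have [n] := Uab; exists n; exact/asboolP.
case: (ex_minnP ex) => n /asboolP abn nmin; exists n; split=> // m abm.
by apply: nmin; exact/asboolP.
Qed.

(** Every element other than a fixed a0 is the end of a path from a0, and the last
step of that path writes it as v s with v an entry of U. *)
Lemma universal_fg_right_fg : (exists a : S, True) -> universal_fg S -> right_fg S.
Proof.
move=> [a0 _] [U [Ufin /generates_universalP Useq]].
exists ([set a0] `|` (fst @` U `|` snd @` U)); split.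
  rewrite !finite_setU; do !split=> //; exact: finite_image.
apply/seteqP; split=> // b _.
have [[|n]] := Useq a0 b.
  move=> /U_sequence0 <-; have [o So o1] := S1_unit.
  by exists a0; [left|exists o].
move=> /U_sequenceSr[c [_ [u [v [s [uv Ss _ ->]]]]]].
exists v; last by exists s.
by right; case: uv => Uuv; [right; exists (u, v)|left; exists (v, u)].
Qed.

(** An upper bound for one U and a lower bound for every U, the latter attained by
a pair of elements, so that an infinite supremum needs no separate treatment. *)
Lemma is_right_diameterP (n : nat) :
  (exists U, finite_set U /\ forall a b, U_sequence U n a b) ->
  (forall U, finite_set U -> generates_universal U ->
    exists a b, forall m, U_sequence U m a b -> (n <= m)%N) ->
  is_right_diameter S (n%:Z)%:E.
Proof.
move=> [U [Ufin Un]] lower.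
have ge_n V (d : \bar int) : finite_set V -> generates_universal V ->
    ubound [set (m%:Z)%:E | m in
             [set m | exists a b : S, is_right_distance V a b m]] d ->
    ((n%:Z)%:E <= d)%O.
  move=> Vfin Vgen; have [a [b abn]] := lower V Vfin Vgen.
  have [m [abm abmin]] := exists_right_distance V a b Vgen.
  move=> dub; apply: (@le_trans _ _ (m%:Z)%:E).
    by rewrite lee_fin lez_nat; exact: abn.
  by apply: dub; exists m => //; exists a, b.
have Ugen : generates_universal U.
  by apply/generates_universalP => a b; exists n; exact: Un.
split; last by move=> d [V [Vfin Vgen [dub _]]]; exact: ge_n dub.
exists U; split=> //; split; last by move=> d; exact: ge_n.
move=> _ [m [a [b [_ abmin]]] <-].
by rewrite lee_fin lez_nat; exact: abmin.
Qed.

End Sequences.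

(** * Transitivity: extending and separating *)

Section TransitiveSemigroup.
Context {X : Type} {S : mulgClosed (transf X)}.
Hypothesis Xinf : infinite_set [set: X].
Hypothesis Sinj : [set` S] `<=` @inj_maps X.
Hypothesis Strans : transitive_wrt [set: X] ([set` S] `\` @baer_levi X).
Local Open Scope card_scope.
Implicit Types (a b : sub_semigroup S).

Lemma transf_of_inj a : injective (transf_of a).
Proof. exact: Sinj (valP a). Qed.

Lemma exists_element (f : transf X) : [set` S] f ->
  exists a : sub_semigroup S, transf_of a = f.
Proof. by move=> Sf; exists (Sub f Sf); rewrite SubK. Qed.

Definition act1 (o : option (sub_semigroup S)) : X -> X :=
  if o is Some s then transf_of s else id.

Lemma act1_inj o : injective (act1 o).
Proof. by case: o => [s|]; [exact: transf_of_inj|]. Qed.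

Lemma transf_of_mul1 a o x : transf_of (mul1 a o) x = act1 o (transf_of a x).
Proof. by case: o. Qed.

Lemma eq_transf a b : (forall x, transf_of a x = transf_of b x) -> a = b.
Proof. by move=> ab; apply: val_inj; apply/funext. Qed.

(** Transitivity for the partial bijection that sends u i to v i.  With an arbitrary
index type, this serves countable selections of points (I = nat), the image of one
map (I = X) and the images of two maps (I = X + X). *)
Lemma extension {I : Type} (u v : I -> X) : injective u -> injective v ->
  large (~` range u) -> large (~` range v) ->
  exists a, ~ @baer_levi X (transf_of a) /\ forall i, transf_of a (u i) = v i.
Proof.
move=> uinj vinj ul vl.
pose f x := if pselect (exists i, u i = x) is left e then v (sval (cid e)) else x.
have fu i : f (u i) = v i.
  rewrite /f; case: pselect => [e|[]]; last by exists i.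
  by case: cid => j /= /uinj ->.
have frange : f @` range u = range v.
  by rewrite image_comp; apply: eq_imagel => i _; exact: fu.
have [] := @Strans (range u) f.
- by move=> x y /set_mem[i _ <-] /set_mem[j _ <-]; rewrite !fu => /vinj ->.
- exact: card_leT.
- exact/card_eqT_large.
- by rewrite frange; exact/card_eqT_large.
move=> g [/exists_element[a <-] gBL] gf; exists a; split=> // i.
by rewrite -fu; apply: gf; exists i.
Qed.

(** Countably many prescriptions  a p = b q <-> R p q  can be violated at once:
choose the p n distinct, the q n distinct, and let b (q n) be equal to a (p n) or
to a fresh point, whichever contradicts R at (p n, q n).  The values lie in an
injective sequence e of which only even positions are used, and p and q use every
other term of a selection, so that domains and images have large complements, as
transitivity requires. *)
Lemma separation (A B : nat -> set X) (R : nat -> X -> X -> Prop) :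
  exists a b, [/\ ~ @baer_levi X (transf_of a), ~ @baer_levi X (transf_of b) &
    forall n, infinite_set (A n) -> infinite_set (B n) ->
      exists p q, [/\ A n p, B n q &
        ~ (transf_of a p = transf_of b q <-> R n p q)]].
Proof.
have select (C : nat -> set X) : exists2 p : nat -> X, injective p &
    large (~` range p) /\ forall n, infinite_set (C n) -> C n (p n).
  (* Each infinite [C n] occurs twice in [C'], so half of a selection suffices. *)
  pose C' n := if pselect (infinite_set (C n./2)) then C n./2 else setT.
  have [|p pinj pC] := injective_selector Xinf C'.
    by move=> n; rewrite /C'; case: pselect.
  exists (p \o double); first exact: inj_comp double_inj.
  split=> [|n Cinf]; first exact: large_compl_even_range.
  by have := pC n.*2; rewrite /C' doubleK; case: pselect.
have [p pinj [pl pA]] := select A; have [q qinj [ql qB]] := select B.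
have [e einj _] := injective_selector Xinf (fun=> setT) (fun=> Xinf).
(* The point p n will go to position 4n of e, and q n to 4n or to 4n + 2. *)
pose r n : X := if pselect (R n (p n) (q n)) then e n.*2.+1.*2 else e n.*2.*2.
have el (u : nat -> X) : injective u -> range u `<=` range (e \o double) ->
    large (~` range u).
  move=> uinj ue; apply: large_sub (large_compl_even_range e einj).
  exact: subsetC.
have pinj' : injective (fun n => e n.*2.*2).
  by move=> m n /einj/double_inj/double_inj.
have [a [aBL ap]] : exists a, ~ @baer_levi X (transf_of a) /\
    forall n, transf_of a (p n) = e n.*2.*2.
  by apply: extension => //; apply: el => // _ [n _ <-]; exists n.*2.
have rinj : injective r.
  move=> m n; rewrite /r.
  have neq k l : k.*2.+1 <> l.*2.
    by move=> /(congr1 odd); rewrite /= !odd_double.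
  case: pselect => ?; case: pselect => ? /einj/double_inj.
  - by move=> [] /double_inj.
  - by move/neq.
  - by move/esym/neq.
  - by move/double_inj.
have [b [bBL bq]] : exists b, ~ @baer_levi X (transf_of b) /\
    forall n, transf_of b (q n) = r n.
  apply: extension => //; apply: el => // _ [n _ <-]; rewrite /r.
  by case: pselect => ?; [exists n.*2.+1|exists n.*2].
exists a, b; split=> // n An Bn; exists (p n), (q n); split; [exact: pA|exact: qB|].
rewrite ap bq /r; case: pselect => Rn; last by move=> [/(_ erefl)].
by move=> [_ /(_ Rn)/einj/double_inj/(congr1 odd)]; rewrite /= !odd_double.
Qed.

(** * Paths as partial injections *)

(** An injection s carries the complement of the image of u into the complement of
the image of u s. *)
Lemma baer_levi_post (u s : X -> X) : injective s -> @baer_levi X u ->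
  @baer_levi X (s \o u).
Proof.
move=> sinj /(baer_levi_large Xinf)[uinj ul]; apply/(baer_levi_large Xinf).
split; first exact: inj_comp.
apply: large_sub (large_image _ _ sinj ul) => _ [x xu <-] [y _ /sinj yx].
by apply: xu; exists y.
Qed.

(** Otherwise the large image of v would lie, up to a finite set, in the complement
of the image of u. *)
Lemma infinite_coincidence (u v : X -> X) : injective u -> injective v ->
  ~ @baer_levi X u -> infinite_set [set p | exists x, u p = v x].
Proof.
move=> uinj vinj uBL; set P := [set p | _] => Pfin.
have /largeU[||] : large (u @` P `|` ~` range u) => //.
- apply: large_sub (large_range _ vinj) => _ [x _ <-].
  have [[p _ pE]|] := pselect (range u (v x)); last by right.
  by left; exists p => //; exists x.
- by move=> /(large_infinite Xinf); apply; exact: finite_image.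
- by move=> ul; apply: uBL; exact/(baer_levi_large Xinf).
Qed.

Section Links.
Variable c : nat -> (X -> X) * (X -> X).

Definition link (n : nat) (f g : X -> X) := exists2 s : X -> X, injective s &
  f = s \o (c n).1 /\ g = s \o (c n).2.

(** The first letter of the word is the last link of the path. *)
Fixpoint linked (w : seq nat) (f g : X -> X) :=
  if w is n :: w' then exists2 h, linked w' f h & link n h g else f = g.

(** The partial injection through which the end of a path factors: the composite
of the v u^{-1} over the pairs (u, v) of the path, last pair first. *)
Fixpoint transport (w : seq nat) (x y : X) :=
  if w is n :: w' then exists2 z, (c n).2 x = (c n).1 z & transport w' z y
  else x = y.

Lemma linked_transport w f g x y : linked w f g -> transport w x y -> g x = f y.
Proof.
elim: w g x => [|n w IHw] g x /=; first by move=> -> ->.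
move=> [h fh [s _ [hE gE]]] [z xz zy].
by rewrite -(IHw h z fh zy) hE gE /= xz.
Qed.

Hypothesis cinj : forall n, injective (c n).1 /\ injective (c n).2.

(** A point x leaves the domain of the composite either because v x is outside
the image of u, or because the point z with v x = u z is outside the domain of the
shorter composite; each of these sets of x injects into a small set. *)
Lemma transport_dom_cosmall w : (forall n, ~ @baer_levi X (c n).1) ->
  ~ large [set x | ~ exists y, transport w x y].
Proof.
move=> cBL; elim: w => [|n w IHw] /=.
  move=> [f _ ff]; have [x _] := infinite_setN0 Xinf.
  by case: (ff x); exists (f x).
have [uinj vinj] := cinj n; set u := (c n).1 in uinj *; set v := (c n).2 in vinj *.
set P := [set x | _] => Pl.
have /largeU[||] : large ([set x | ~ range u (v x)] `|`
  [set x | exists2 z, v x = u z & ~ exists y, transport w z y]) => //.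
- apply: large_sub Pl => x Px.
  have [[z _ zx]|] := pselect (range u (v x)); last by left.
  by right; exists z => // -[y zy]; apply: Px; exists y, z.
- move=> /(large_image _ _ vinj) ul; apply: (cBL n).
  apply/(baer_levi_large Xinf); split=> //.
  by apply: large_sub ul => _ [x xu <-].
- move=> [f finj /= fP]; apply: IHw.
  have /choice[z zP] : forall x, exists z,
      v (f x) = u z /\ ~ exists y, transport w z y.
    by move=> x; have [z] := fP x; exists z.
  exists z => [x y zxy|x]; last by have [] := zP x.
  by apply/finj/vinj; rewrite (zP x).1 (zP y).1 zxy.
Qed.

End Links.

(** The pairs of U and of its converse form a finite list, which c extends by the
constant value (id, id); this trivial pair makes it possible to lengthen paths at
will. *)
Lemma exists_links (U : set (sub_semigroup S * sub_semigroup S)) : finite_set U ->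
  exists c : nat -> (X -> X) * (X -> X),
  [/\ forall n, c n = (id, id) \/
        exists a b, c n = (transf_of a, transf_of b),
      exists n, c n = (id, id) &
      forall a b, elementary_step U a b ->
        exists n, link c n (transf_of a) (transf_of b)].
Proof.
move=> /finite_seqP[s UE]; pose t := s ++ [seq (p.2, p.1) | p <- s].
pose c n : (X -> X) * (X -> X) :=
  if nth None (map some t) n is Some p then (transf_of p.1, transf_of p.2)
  else (id, id).
exists c; split=> [n||a b [u [v [o [Uuv _ aE bE]]]]].
- rewrite /c; case: (nth _ _ _) => [[a b]|]; last by left.
  by right; exists a, b.
- by exists (size t); rewrite /c nth_default // size_map.
have uvt : (u, v) \in t.
  rewrite mem_cat; apply/orP; case: Uuv; rewrite UE /= => uvs; first by left.
  by right; apply/mapP; exists (v, u).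
exists (index (u, v) t), (act1 o); first exact: act1_inj.
rewrite /c (nth_map (u, v)) ?index_mem // nth_index //= aE bE.
by split; apply/funext => x; rewrite transf_of_mul1.
Qed.

Lemma U_sequence_linked (U : set (sub_semigroup S * sub_semigroup S))
    (c : nat -> (X -> X) * (X -> X)) m n a b :
  (exists n, c n = (id, id)) ->
  (forall a b, elementary_step U a b ->
     exists n, link c n (transf_of a) (transf_of b)) ->
  U_sequence U m a b -> (m <= n)%N ->
  exists2 w, size w = n & linked c w (transf_of a) (transf_of b).
Proof.
move=> [i ci] clink; elim: n m b => [|n IHn] m b.
  by case: m => // /U_sequence0 <- _; exists [::].
case: m => [/U_sequence0 <- _|m /U_sequenceSr[d [ad db]] mn].
  have [|w wn aw] := IHn 0%N a _ isT; first exact/U_sequence0.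
  exists (i :: w); rewrite /= ?wn //; exists (transf_of a) => //.
  by exists (transf_of a); [exact: transf_of_inj|rewrite ci].
have [w wn aw] := IHn m d ad mn; have [k dk] := clink _ _ db.
by exists (k :: w); rewrite /= ?wn //; exists (transf_of d).
Qed.

(** Words over U are countably many.  If none of the maps involved lies in BL, then
a path labelled w from a to b forces  a p = b q <-> transport w q p  for all p and
all q in an infinite set, which suitable a and b contradict for every w. *)
Lemma universal_fg_baer_levi : universal_fg (sub_semigroup S) ->
  [set` S] `&` @baer_levi X !=set0.
Proof.
move=> [U [Ufin /generates_universalP Useq]]; apply: contrapT => noBL.
have [c [cS cid clink]] := exists_links U Ufin.
have cinj n : injective (c n).1 /\ injective (c n).2.
  by have [->|[a [b ->]]] := cS n; split=> //=; exact: transf_of_inj.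
have cBL n : ~ @baer_levi X (c n).1.
  have [->|[a [b ->]]] /= := cS n; last first.
    by move=> aBL; apply: noBL; exists (transf_of a); split=> //; exact: valP.
  move=> /(baer_levi_large Xinf)[_ [f _ fid]].
  by have [x _] := infinite_setN0 Xinf; apply: (fid x); exists (f x).
have dom_inf w : infinite_set [set x | exists y, transport c w x y].
  apply: (large_infinite Xinf).
  have /largeU[//|//|/(transport_dom_cosmall c cinj w cBL)//] :
    large ([set x | exists y, transport c w x y] `|`
           [set x | ~ exists y, transport c w x y]).
  apply: large_sub (large_range id _) => // x _.
  by have [] := pselect (exists y, transport c w x y); [left|right].
pose word n : seq nat := odflt [::] (unpickle n).
have [a [b [_ _ abP]]] := separation (fun=> setT)
  (fun n => [set x | exists y, transport c (word n) x y])
  (fun n p q => transport c (word n) q p).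
have [n abn] := Useq a b.
have [w _ abw] := U_sequence_linked U c n n a b cid clink abn (leqnn n).
have wE : word (pickle w) = w by rewrite /word pickleK.
have [p [q [_ [y]]]] := abP (pickle w) Xinf (dom_inf _).
rewrite wE => qy; apply.
have bq := fun x y => linked_transport c w _ _ x y abw.
split=> [|/bq //]; rewrite (bq _ _ qy) => /transf_of_inj -> //.
Qed.

(** A path of length at most 3, padded to length 3, forces  a p = b q  exactly when
the middle pair identifies the points reached from p and q.  Since a and b are
outside BL, so are the first map of the first pair and the second map of the last
pair, and infinitely many p and q are available. *)
Lemma distance_ge4 (U : set (sub_semigroup S * sub_semigroup S)) : finite_set U ->
  exists a b, forall m, U_sequence U m a b -> (4 <= m)%N.
Proof.
move=> Ufin; have [c [cS cid clink]] := exists_links U Ufin.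
have cinj n : injective (c n).1 /\ injective (c n).2.
  by have [->|[a [b ->]]] := cS n; split=> //=; exact: transf_of_inj.
(* Words come with the last link first: letter 2 is the step that leaves a, and
   letter 0 the step that reaches b. *)
pose u n i := (c (nth 0%N (odflt [::] (unpickle n)) i)).1.
pose v n i := (c (nth 0%N (odflt [::] (unpickle n)) i)).2.
have [a [b [aBL bBL abP]]] := separation
  (fun n => [set p | exists x, u n 2 p = v n 2 x])
  (fun n => [set q | exists y, v n 0 q = u n 0 y])
  (fun n p q => exists x y,
     [/\ u n 2 p = v n 2 x, v n 0 q = u n 0 y & u n 1 x = v n 1 y]).
exists a, b => m abm; rewrite ltnNge; apply/negP => m3.
have [w w3] := U_sequence_linked U c m 3 a b cid clink abm m3.
case: w w3 => [|k [|j [|i []]]] //= _.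
move=> [g [f [_ <- [s1 s1i [aE fE]]] [s2 s2i [fE' gE]]] [s3 s3i [gE' bE]]].
have := abP (pickle [:: k; j; i]); rewrite /u /v pickleK /=.
case.
- apply: infinite_coincidence; [exact: (cinj _).1|exact: (cinj _).2|].
  by move=> /(baer_levi_post _ _ s1i); rewrite -aE.
- apply: infinite_coincidence; [exact: (cinj _).2|exact: (cinj _).1|].
  by move=> /(baer_levi_post _ _ s3i); rewrite -bE.
have ap p x : (c i).1 p = (c i).2 x -> transf_of a p = s2 ((c j).1 x).
  by move=> px; rewrite aE /= px -[LHS]/((s1 \o (c i).2) x) -fE fE'.
have bq q y : (c k).2 q = (c k).1 y -> transf_of b q = s2 ((c j).2 y).
  by move=> qy; rewrite bE /= qy -[LHS]/((s3 \o (c k).1) y) -gE' gE.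
move=> p [q [[x px] [y qy]]]; apply; split.
  by rewrite (ap _ _ px) (bq _ _ qy) => /s2i xy; exists x, y.
by move=> [x' [y' [/ap -> /bq -> ->]]].
Qed.

(** * Factoring through the Baer-Levi semigroup *)

(** If alpha in S and gamma both lie in BL, then alpha^{-1} gamma is a partial
bijection to which transitivity applies. *)
Lemma baer_levi_sub : [set` S] `&` @baer_levi X !=set0 ->
  @baer_levi X `<=` [set` S].
Proof.
move=> [f [/exists_element[a <-] /(baer_levi_large Xinf)[ainj al]]] g.
move=> /(baer_levi_large Xinf)[ginj gl].
have [s [_ sE]] := extension _ _ ainj ginj al gl.
suff -> : g = transf_of (a * s)%g by exact: valP.
by apply/funext => x; rewrite -sE.
Qed.

(** Two of the four steps replace a and b by products with e0 or e1 whose images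
leave a large set uncovered; the other two go through a map h with image inside
that set, using the pair (e0, e1) in both directions. *)
Lemma sequence_length4 : right_fg (sub_semigroup S) -> @baer_levi X `<=` [set` S] ->
  exists U, finite_set U /\ forall a b, U_sequence U 4 a b.
Proof.
move=> [V [Vfin Vgen]] BLS.
have [e eP] := disjoint_copies Xinf.
have einj i : injective (e i) by move=> x y /eP[].
have e_neq i j x y : i <> j -> e i x <> e j y by move=> + /eP[].
have e_elt i : exists a, transf_of a = e i.
  apply/exists_element/BLS/(baer_levi_large Xinf); split=> //.
  apply: large_sub (large_range _ (einj i.+1)) => _ [x _ <-] [y _].
  by apply: e_neq => /n_Sn.
have [g0 g0E] := e_elt 0%N; have [g1 g1E] := e_elt 1%N.
pose U := (fun v => (v, g0)) @` V `|` (fun v => (v, g1)) @` V `|` [set (g0, g1)].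
exists U; split.
  by rewrite !finite_setU; do !split=> //; exact: finite_image.
have factor a : exists c0 c1 f, [/\ injective f,
    elementary_step U a c0, elementary_step U a c1,
    (forall x, transf_of c0 x = f (e 0%N x)) &
    (forall x, transf_of c1 x = f (e 1%N x))].
  have : [set mul1 v s | v in V & s in S1 (S:=sub_semigroup S)] a by rewrite Vgen.
  move=> [v Vv [o So <-]]; exists (mul1 g0 o), (mul1 g1 o), (act1 o); split.
  - exact: act1_inj.
  - by exists v, g0, o; split=> //; left; left; left; exists v.
  - by exists v, g1, o; split=> //; left; left; right; exists v.
  - by move=> x; rewrite transf_of_mul1 g0E.
  - by move=> x; rewrite transf_of_mul1 g1E.
(* With h = k e0, the part of the image of k that comes from e1 stays outside the
   images of a and h, which makes room for the extension. *)
have bridge a (k : X -> X) : injective k -> (forall x, ~ range (transf_of a) (k x)) ->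
    exists s, (g0 * s)%g = a /\ forall x, transf_of (g1 * s)%g x = k (e 0%N x).
  move=> kinj ka.
  pose u (z : X + X) := match z with inl x => e 0%N x | inr x => e 1%N x end.
  pose t (z : X + X) := match z with inl x => transf_of a x | inr x => k (e 0%N x) end.
  have [||||s [_ sE]] := extension u t.
  - by move=> [x|x] [y|y] /= /eP[] // _ ->.
  - move=> [x|x] [y|y] /=.
    + by move=> /transf_of_inj ->.
    + by move=> axk; case: (ka (e 0%N y)); exists x.
    + by move=> axk; case: (ka (e 0%N x)); exists y.
    + by move=> /kinj /einj ->.
  - apply: large_sub (large_range _ (einj 2)) => _ [x _ <-] [[y|y] _]; exact: e_neq.
  - apply: large_sub (large_range _ (inj_comp kinj (einj 1%N))) => _ [x _ <-].
    move=> [[y|y] _ /=]; last by move=> /kinj; exact: e_neq.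
    by move=> ay; apply: (ka (e 1%N x)); exists y.
  exists s; split=> [|x].
    by apply: eq_transf => x; move: (sE (inl x)); rewrite /= -g0E.
  by move: (sE (inr x)); rewrite /= -g1E.
have middle a b : large (~` (range (transf_of a) `|` range (transf_of b))) ->
    U_sequence U 2 a b.
  move=> [k kinj kab].
  have [s [sa sk]] : exists s, (g0 * s)%g = a /\
      forall x, transf_of (g1 * s)%g x = k (e 0%N x).
    by apply: bridge => // x xa; apply: (kab x); left.
  have [t [tb tk]] : exists s, (g0 * s)%g = b /\
      forall x, transf_of (g1 * s)%g x = k (e 0%N x).
    by apply: bridge => // x xb; apply: (kab x); right.
  have st : (g1 * s)%g = (g1 * t)%g by apply: eq_transf => x; rewrite sk tk.
  apply/U_sequenceSr; exists (g1 * s)%g; split.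
    by apply/U_sequence1; exists g0, g1, (Some s); split=> //; left; right.
  by rewrite st; exists g1, g0, (Some t); split=> //; right; right.
have via a b a' b' : elementary_step U a a' -> elementary_step U b b' ->
    large (~` (range (transf_of a') `|` range (transf_of b'))) -> U_sequence U 4 a b.
  move=> /U_sequence1 aa' /U_sequence1/U_sequence_sym bb' /middle ab'.
  exact: U_sequence_trans aa' (U_sequence_trans _ 2 1 _ _ _ ab' bb').
move=> a b; have [c0 [c1 [f [finj ac0 ac1 c0E c1E]]]] := factor a.
have [d0 [d1 [h [hinj bd0 _ d0E d1E]]]] := factor b.
(* The part of the image of d1 that avoids c is disjoint from the image of d0. *)
pose D (c : sub_semigroup S) := range (transf_of d1) `&` ~` range (transf_of c).
have : large (D c0 `|` D c1).
  apply: large_sub (large_range _ (transf_of_inj d1)) => y d1y.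
  have [[x _ xy]|] := pselect (range (transf_of c1) y); last by right.
  left; split=> // -[z _ zy]; move: xy; rewrite -zy c0E c1E => /finj.
  exact: e_neq.
have DE c : D c `<=` ~` (range (transf_of c) `|` range (transf_of d0)).
  by move=> _ [[x _ <-] xc] [//|[y _]]; rewrite d0E d1E => /hinj; exact: e_neq.
by move=> /(largeU Xinf)[] /(large_sub _ _ (DE _)); exact: via.
Qed.

End TransitiveSemigroup.

Theorem theorem3p16 (X : Type) (S : mulgClosed (transf X)) :
  infinite_set [set: X] ->
  [set` S] `<=` @inj_maps X ->
  transitive_wrt [set: X] ([set` S] `\` @baer_levi X) ->
  [<-> universal_fg (sub_semigroup S) /\
         is_right_diameter (sub_semigroup S) (4%:Z)%:E;
       universal_fg (sub_semigroup S);
       right_fg (sub_semigroup S) /\ [set` S] `&` @baer_levi X !=set0;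
       right_fg (sub_semigroup S) /\ @baer_levi X `<=` [set` S]].
Proof.
move=> Xinf Sinj Strans; tfae.
- by case.
- move=> Ufg; split; last exact: universal_fg_baer_levi.
  apply: universal_fg_right_fg Ufg.
  have [a] := separation Xinf Strans (fun=> setT) (fun=> setT) (fun _ _ _ => True).
  by exists a.
- by move=> [Sfg SBL]; split=> //; exact: baer_levi_sub.
- move=> [Sfg BLS].
  have [U [Ufin U4]] := sequence_length4 Xinf Sinj Strans Sfg BLS.
  split.
    by exists U; split=> //; apply/generates_universalP => a b; exists 4%N.
  apply: is_right_diameterP; first by exists U.
  by move=> V Vfin _; exact: distance_ge4.
Qed.
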